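(* Let $\theta\in\mathbb{R}$ and let $\mathcal{A}_\theta\otimes\mathcal{A}_\theta=C^*(u_1,u_2)\otimes C^*(u_3,u_4)$ be the $4$-dimensional noncommutative torus generated by unitaries $u_1,u_2,u_3,u_4$ satisfying $u_2u_1=\exp(2\pi i\theta)u_1u_2$, $u_4u_3=\exp(2\pi i\theta)u_3u_4$, and $u_ku_l=u_lu_k$ for $k=1,2$ and $l=3,4$. Then for each $n\in\{5,8,10,12\}$, $\mathcal{A}_\theta\otimes\mathcal{A}_\theta$ admits a canonical action $\alpha_n$ of $\mathbb{Z}_n=\langle A_n\rangle$, where $$A_5=\begin{pmatrix}0&-1&0&-1\\1&-1&0&-1\\0&0&0&-1\\-1&0&1&0\end{pmatrix},\quad A_8=\begin{pmatrix}0&0&0&-1\\0&0&1&0\\1&0&0&0\\0&1&0&0\end{pmatrix},$$ $$A_{10}=\begin{pmatrix}0&-1&0&-1\\1&1&0&1\\0&0&0&-1\\-1&0&1&0\end{pmatrix},\quad A_{12}=\begin{pmatrix}0&0&0&-1\\0&0&1&1\\1&0&0&0\\0&1&0&0\end{pmatrix}$$ are of order $5,8,10,12$ respectively. More precisely: (1) $\alpha_5:\mathbb{Z}_5\to\mathrm{Aut}(\mathcal{A}_\theta\otimes\mathcal{A}_\theta)$ is induced by the automorphism $u_1\mapsto u_2u_4^*$, $u_2\mapsto \exp(\pi i\theta)u_1^*u_2^*$, $u_3\mapsto u_4$, $u_4\mapsto\exp(\pi i\theta)u_1^*u_2^*u_3^*$. (2) $\alpha_8:\mathbb{Z}_8\to\mathrm{Aut}(\mathcal{A}_\theta\otimes\mathcal{A}_\theta)$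 is induced by the automorphism $u_1\mapsto u_3$, $u_2\mapsto u_4$, $u_3\mapsto u_2$, $u_4\mapsto u_1^*$. (3) $\alpha_{10}:\mathbb{Z}_{10}\to\mathrm{Aut}(\mathcal{A}_\theta\otimes\mathcal{A}_\theta)$ is induced by the automorphism $u_1\mapsto u_2u_4^*$, $u_2\mapsto\exp(-\pi i\theta)u_1^*u_2$, $u_3\mapsto u_4$, $u_4\mapsto\exp(-\pi i\theta)u_1^*u_2u_3^*$. (4) $\alpha_{12}:\mathbb{Z}_{12}\to\mathrm{Aut}(\mathcal{A}_\theta\otimes\mathcal{A}_\theta)$ is induced by the automorphism $u_1\mapsto u_3$, $u_2\mapsto u_4$, $u_3\mapsto u_2$, $u_4\mapsto\exp(-\pi i\theta)u_1^*u_2$.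
   Context: For a real skew symmetric $d\times d$ matrix $\Theta=(\theta_{kj})$, the noncommutative $d$-torus $\mathcal{A}_\Theta$ is the universal $C^*$-algebra generated by unitaries $u_1,\dots,u_d$ subject to $u_ju_k=\exp(2\pi i\theta_{kj})u_ku_j$. Equivalently, $\mathcal{A}_\Theta=C^*(\mathbb{Z}^d,\omega_\Theta)$ is the twisted group $C^*$-algebra for the 2-cocycle $\omega_\Theta(x,y)=\exp(\pi i\langle\Theta x,y\rangle)$, with canonical unitaries $l_\Theta(x)$, $x\in\mathbb{Z}^d$, satisfying $l_\Theta(x)l_\Theta(y)=\omega_\Theta(x,y)l_\Theta(x+y)$, and $u_i=l_\Theta(e_i)$. Let $G_\Theta:=\{A\in \mathrm{GL}_d(\mathbb{Z}): A^t\Theta A=\Theta\}$. For a subgroup $G\subset G_\Theta$, the canonical action of $G$ on $\mathcal{A}_\Theta$ is $\alpha_A(l_\Theta(x))=l_\Theta(Ax)$ for $A\in G$, $x\in\mathbb{Z}^d$. The rotation algebra $\mathcal{A}_\theta$ is the 2-torus with $\theta_{12}=\theta$, i.e. generated universally by unitaries $u_1,u_2$ with $u_2u_1=\exp(2\pi i\theta)u_1u_2$. The algebra $\mathcal{A}_\theta\otimes\mathcal{A}_\theta$ is identified with the 4-torus $\mathcal{A}_\Theta$, $u_i=l_\Theta(e_i)$, for the skew symmetric $4\times4$ matrix $\Theta$ whose only nonzero entries above the diagonal are $\theta_{12}=\theta_{34}=\theta$. A canonical action of $\langle A_n\rangle$ on $\mathcal{A}_\theta\otimes\mathcal{A}_\theta$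 means the canonical action for this $\Theta$; it is generated by the automorphism $l_\Theta(x)\mapsto l_\Theta(A_nx)$. *)

(* Defs.v *)
From mathcomp Require Import all_boot all_order all_algebra.
From mathcomp Require Import all_classical all_reals all_analysis.
From mathcomp Require Import complex.

Set Implicit Arguments.
Unset Strict Implicit.
Unset Printing Implicit Defensive.

Import Order.TTheory GRing.Theory Num.Theory.
Import numFieldNormedType.Exports.

Local Open Scope classical_set_scope.
Local Open Scope ring_scope.

(** * Unital C*-algebras *)

(** The library has no common extension of its algebra and normed module
    structures, so the norm is a field of the record. *)
Record cstarType (R : realType) := CStarAlgebra {
  cstar_alg :> algType R[i];
  star : cstar_alg -> cstar_alg;
  cnorm : cstar_alg -> R;
  starK : involutive star;
  starD : {morph star : x y / x + y};
  starZ : forall (a : R[i]) x, star (a *: x) = Num.conj a *: star x;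
  starM : forall x y, star (x * y) = star y * star x;
  cnorm_eq0 : forall x, cnorm x = 0 -> x = 0;
  cnormD_le : forall x y, cnorm (x + y) <= cnorm x + cnorm y;
  (* [complex.Re `|a|] is the modulus of [a], as a real number *)
  cnormZ : forall (a : R[i]) x, cnorm (a *: x) = complex.Re `|a| * cnorm x;
  cnormM_le : forall x y, cnorm (x * y) <= cnorm x * cnorm y;
  cnorm_star : forall x, cnorm (star x * x) = cnorm x ^+ 2;
  cnorm_complete : forall s : nat -> cstar_alg,
    (forall e : R, 0 < e -> exists N, forall m n,
       (N <= m)%N -> (N <= n)%N -> cnorm (s m - s n) < e) ->
    exists x, forall e : R, 0 < e -> exists N, forall n,
      (N <= n)%N -> cnorm (s n - x) < e
}.

Section CStarAlgebraTheory.
Variable R : realType.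

Definition unitary (A : cstarType R) (x : A) : Prop :=
  star x * x = 1 /\ x * star x = 1.

Definition star_hom (A B : cstarType R) (f : A -> B) : Prop :=
  [/\ linear f, monoid_morphism f & forall x, f (star x) = star (f x)].

Definition star_automorphism (A : cstarType R) (f : A -> A) : Prop :=
  star_hom f /\ bijective f.

(** [expi t] is exp(i t) for a real number [t]. *)
Definition expi (t : R) : R[i] := Complex (cos t) (sin t).

(** * Noncommutative tori *)

Definition nc_relations (d : nat) (Theta : 'M[R]_d) (A : cstarType R)
    (u : 'I_d -> A) : Prop :=
  (forall j, unitary (u j)) /\
  (forall j k, u j * u k = expi (2 * pi * Theta k j) *: (u k * u j)).

(** [A] is the universal C*-algebra generated by unitaries [u j] subject to the
    relations above. The universal property determines [(A, u)] up to a unique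
    isomorphism; uniqueness of [phi] says that [u] generates [A]. *)
Definition is_nc_torus (d : nat) (Theta : 'M[R]_d) (A : cstarType R)
    (u : 'I_d -> A) : Prop :=
  nc_relations Theta u /\
  (forall (B : cstarType R) (v : 'I_d -> B), nc_relations Theta v ->
     exists! phi : A -> B, star_hom phi /\ forall j, phi (u j) = v j).

(** The 2-cocycle exp(pi i <Theta x, y>) on Z^d. *)
Definition omega (d : nat) (Theta : 'M[R]_d) (x y : 'cV[int]_d) : R[i] :=
  expi (pi * ((Theta *m map_mx intr x)^T *m map_mx intr y) 0 0).

Definition canonical_unitaries (d : nat) (Theta : 'M[R]_d) (A : cstarType R)
    (u : 'I_d -> A) (l : 'cV[int]_d -> A) : Prop :=
  [/\ forall x, unitary (l x),
      forall x y, l x * l y = omega Theta x y *: l (x + y)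
    & forall j, u j = l (delta_mx j 0)].

(** * Canonical actions *)

Definition G_ (d : nat) (Theta : 'M[R]_d) : set 'M[int]_d :=
  [set M | M \in unitmx /\
     (map_mx intr M)^T *m Theta *m map_mx intr M = Theta].

Definition is_subgroup (d : nat) (G : set 'M[int]_d) : Prop :=
  [/\ G `<=` [set M | M \in unitmx], G 1%:M,
      forall M N, G M -> G N -> G (M *m N)
    & forall M, G M -> G (invmx M)].

(** The action is a function on all matrices; its values outside [G] are
    irrelevant. *)
Definition canonical_action (d : nat) (Theta : 'M[R]_d) (A : cstarType R)
    (l : 'cV[int]_d -> A) (G : set 'M[int]_d)
    (alpha : 'M[int]_d -> A -> A) : Prop :=
  [/\ is_subgroup G /\ G `<=` G_ Theta,
      forall M, G M -> star_automorphism (alpha M),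
      alpha 1%:M = id,
      forall M N, G M -> G N -> alpha (M *m N) = alpha M \o alpha N
    & forall M x, G M -> alpha M (l x) = l (M *m x)].

Definition cyclic_group (d : nat) (M : 'M[int]_d.+1) : set 'M[int]_d.+1 :=
  [set M ^ k | k in [set: int]].

Definition has_order (d : nat) (M : 'M[int]_d.+1) (n : nat) : Prop :=
  [/\ (0 < n)%N, M ^+ n = 1
    & forall m, (0 < m < n)%N -> M ^+ m <> 1].

Definition Zn_action (A : cstarType R) (n : nat)
    (alpha : 'Z_n -> A -> A) : Prop :=
  [/\ forall k, star_automorphism (alpha k), alpha 0 = id
    & forall j k, alpha (j + k) = alpha j \o alpha k].

(** The canonical action of the cyclic group generated by [M], read as an
    action of Z/n along the isomorphism sending [k] to [M ^+ k]. *)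
Definition canonical_Zn_action (d : nat) (Theta : 'M[R]_d.+1) (A : cstarType R)
    (l : 'cV[int]_d.+1 -> A) (n : nat) (M : 'M[int]_d.+1)
    (alpha : 'Z_n -> A -> A) : Prop :=
  [/\ has_order M n, Zn_action alpha
    & exists2 beta, canonical_action Theta l (cyclic_group M) beta
        & forall k : 'Z_n, alpha k = beta (M ^+ k)].

Definition induced_by (A : cstarType R) (n : nat)
    (alpha : 'Z_n -> A -> A) (phi : A -> A) : Prop :=
  star_automorphism phi /\ forall k : 'Z_n, alpha k = iter k phi.

End CStarAlgebraTheory.

(** * The 4-torus with theta_12 = theta_34 = theta, and the matrices A_n *)

Definition mx4 (T : nmodType) (rows : seq (seq T)) : 'M[T]_4 :=
  \matrix_(i, j) (nth [::] rows i)`_j.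

Definition Theta4 (R : realType) (theta : R) : 'M[R]_4 := mx4
  [:: [::      0; theta;      0;     0];
      [:: -theta;     0;      0;     0];
      [::      0;     0;      0; theta];
      [::      0;     0; -theta;     0]].

Definition A5 : 'M[int]_4 := mx4
  [:: [::  0; -1; 0; -1];
      [::  1; -1; 0; -1];
      [::  0;  0; 0; -1];
      [:: -1;  0; 1;  0]].

Definition A8 : 'M[int]_4 := mx4
  [:: [:: 0; 0; 0; -1];
      [:: 0; 0; 1;  0];
      [:: 1; 0; 0;  0];
      [:: 0; 1; 0;  0]].

Definition A10 : 'M[int]_4 := mx4
  [:: [::  0; -1; 0; -1];
      [::  1;  1; 0;  1];
      [::  0;  0; 0; -1];
      [:: -1;  0; 1;  0]].

Definition A12 : 'M[int]_4 := mx4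
  [:: [:: 0; 0; 0; -1];
      [:: 0; 0; 1;  1];
      [:: 1; 0; 0;  0];
      [:: 0; 1; 0;  0]].

Lemma Theta4_skew (R : realType) (theta : R) :
  (Theta4 theta)^T = - Theta4 theta.
Proof.
apply/matrixP => i j; rewrite !mxE.
by case: i => [[|[|[|[|?]]]] ?] //; case: j => [[|[|[|[|?]]]] ?] //=;
  rewrite ?oppr0 ?opprK.
Qed.

Lemma expi0 (R : realType) : expi (0 : R) = 1.
Proof. by rewrite /expi cos0 sin0. Qed.

Lemma expiD (R : realType) (s t : R) : expi (s + t) = expi s * expi t.
Proof.
rewrite /expi cosD sinD; simpc.
by rewrite [X in Complex _ X]addrC [sin s * _]mulrC [sin t * _]mulrC.
Qed.

(** For [Theta4] the relations are those of the tensor square of the rotation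
    algebra. *)
Lemma nc_relations_Theta4 (R : realType) (theta : R) (A : cstarType R)
    (u1 u2 u3 u4 : A) :
  nc_relations (Theta4 theta) (tnth [tuple u1; u2; u3; u4]) <->
  [/\ [/\ unitary u1, unitary u2, unitary u3 & unitary u4],
      u2 * u1 = expi (2 * pi * theta) *: (u1 * u2),
      u4 * u3 = expi (2 * pi * theta) *: (u3 * u4)
    & [/\ u3 * u1 = u1 * u3, u4 * u1 = u1 * u4,
          u3 * u2 = u2 * u3 & u4 * u2 = u2 * u4]].
Proof.
split=> [[U C]|[[U1 U2 U3 U4] C21 C43 [C31 C41 C32 C42]]].
  split.
  - by split; [have := U 0|have := U 1|have := U 2|have := U 3].
  - by have := C 1 0; rewrite !(tnth_nth 0) !mxE /=.
  - by have := C 3 2; rewrite !(tnth_nth 0) !mxE /=.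
  - by split; [have := C 2 0|have := C 3 0|have := C 2 1|have := C 3 1];
      rewrite !(tnth_nth 0) !mxE /= mulr0 expi0 scale1r.
split.
  by case=> [[|[|[|[|?]]]] ?] //; rewrite (tnth_nth 0).
have inv (t : R) (x y : A) :
    y * x = expi t *: (x * y) -> x * y = expi (- t) *: (y * x).
  by move=> ->; rewrite scalerA -expiD addNr expi0 scale1r.
move=> [[|[|[|[|?]]]] ?] // [[|[|[|[|?]]]] ?] //;
  rewrite !(tnth_nth 0) !mxE /= ?mulr0 ?expi0 ?scale1r // mulrN; exact: inv.
Qed.

(* Main.v *)
(** The Weyl operators
      l(x) = exp(pi i theta (x1 x2 + x3 x4)) u1^x1 u2^x2 u3^x3 u4^x4
    satisfy the cocycle relation for omega, and a cocycle family is determined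
    by its values on the basis vectors. If M preserves Theta, then
    j |-> l (M e_j) satisfies the relations of the torus, so the universal
    property yields an endomorphism l(x) |-> l(M x); its uniqueness part makes
    M |-> (this endomorphism) multiplicative, hence an action by automorphisms.
    What remains is arithmetic of integer matrices, and reading l off
    the columns of the matrices A_n. *)

Require Import Defs.
From mathcomp Require Import all_boot all_order all_algebra.
From mathcomp Require Import all_classical all_reals all_analysis.
From mathcomp Require Import complex ring.

Set Implicit Arguments.
Unset Strict Implicit.
Unset Printing Implicit Defensive.

Import Order.TTheory GRing.Theory Num.Theory.
Import numFieldNormedType.Exports.

Local Open Scope classical_set_scope.
Local Open Scope ring_scope.

(** * Integer powers of unitaries and Weyl operators of a pair *)

Section Unitaries.
Variables (R : realType) (A : cstarType R).
Implicit Types (t : R) (x y u v : A) (m n : int).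

Lemma conj_expi t : Num.conj (expi t) = expi (- t).
Proof. by rewrite /expi cosN sinN. Qed.

(* [scalerAl] and [scalerAr] restricted to [A]: the general forms also match
   products of scalars, through the regular algebra. *)
Lemma cscalerAl (a : R[i]) x y : a *: x * y = a *: (x * y).
Proof. exact/esym/scalerAl. Qed.

Lemma cscalerAr (a : R[i]) x y : x * (a *: y) = a *: (x * y).
Proof. exact/esym/scalerAr. Qed.

Lemma cscalerMM (a b : R[i]) x y : (a *: x) * (b *: y) = (a * b) *: (x * y).
Proof. by rewrite cscalerAl cscalerAr scalerA. Qed.

Lemma star1 : star (1 : A) = 1.
Proof. by rewrite -[RHS]starK -[star 1 in RHS]mulr1 starM starK mulr1. Qed.

Lemma unitary1 : unitary (1 : A).
Proof. by split; rewrite star1 mulr1. Qed.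

Lemma unitaryM x y : unitary x -> unitary y -> unitary (x * y).
Proof.
move=> [x1 x2] [y1 y2]; split; rewrite starM !mulrA.
  by rewrite -[_ * _ * x]mulrA x1 mulr1.
by rewrite -[x * _ * _]mulrA y2 mulr1.
Qed.

Lemma unitary_star x : unitary x -> unitary (star x).
Proof. by case=> x1 x2; split; rewrite starK. Qed.

Lemma unitaryZ t x : unitary x -> unitary (expi t *: x).
Proof.
case=> x1 x2; split; rewrite starZ conj_expi cscalerMM -expiD.
  by rewrite addNr expi0 scale1r.
by rewrite subrr expi0 scale1r.
Qed.

Lemma unitaryI x y z : unitary x -> x * y = x * z -> y = z.
Proof. by case=> x1 _ e; rewrite -[y]mul1r -x1 -mulrA e mulrA x1 mul1r. Qed.

(** Negative powers are powers of [star u], the inverse of [u] when [u] is unitary; [Negz k] stands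
    for -(k+1), hence the exponent [k.+1]. *)
Definition upow u m : A :=
  match m with Posz k => u ^+ k | Negz k => star u ^+ k.+1 end.

Lemma upowS u m : unitary u -> upow u (m + 1) = u * upow u m.
Proof.
case=> u1 u2; case: m => [k|[|k]].
- by rewrite -PoszD addn1 /= exprS.
- by rewrite /= expr1 u2.
- rewrite [upow u (Negz k.+1)]/= [star u ^+ _]exprS mulrA u2 mul1r.
  by rewrite !NegzE -[k.+2]addn1 PoszD opprD subrK -NegzE.
Qed.

Lemma upowP u m : unitary u -> upow u (m - 1) = star u * upow u m.
Proof.
move=> uu; apply: (unitaryI uu).
by rewrite -upowS // subrK mulrA (proj2 uu) mul1r.
Qed.

Lemma unitary_upow u m : unitary u -> unitary (upow u m).
Proof.
move=> uu; elim/int_ind: m => [|k IH|k IH]; first exact: unitary1.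
  by rewrite -addn1 PoszD upowS //; apply: unitaryM.
rewrite -addn1 PoszD opprD upowP //; apply: unitaryM => //.
exact: unitary_star.
Qed.

Lemma upowD u m n : unitary u -> upow u (m + n) = upow u m * upow u n.
Proof.
move=> uu; elim/int_ind: m => [|k IH|k IH]; first by rewrite add0r mul1r.
  by rewrite -addn1 PoszD addrAC !upowS // IH mulrA.
by rewrite -addn1 PoszD opprD addrAC !upowP // IH mulrA.
Qed.

(** Insert [star u * u] in front of [x], exchange [u] and [x] at the cost of the inverse phase, and
    cancel [u * star u]. *)
Lemma commute_phase_star t u x : unitary u ->
  x * u = expi t *: (u * x) -> x * star u = expi (- t) *: (star u * x).
Proof.
move=> [u1 u2] xu; rewrite -[x in LHS]mul1r -u1 -!mulrA [u * _]mulrA.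
rewrite -[u * x]scale1r -(expi0 R) -(addNr t) expiD -scalerA -xu.
by rewrite cscalerAl cscalerAr -mulrA u2 mulr1.
Qed.

Lemma commute_phase_upow t u x m : unitary u ->
  x * u = expi t *: (u * x) ->
  x * upow u m = expi (t * m%:~R) *: (upow u m * x).
Proof.
move=> uu xu; have xsu := commute_phase_star uu xu.
elim/int_ind: m => [|k IH|k IH].
- by rewrite mulr0 expi0 scale1r /= expr0 mulr1 mul1r.
- rewrite -addn1 PoszD upowS // mulrA xu cscalerAl.
  rewrite -[u * x * _]mulrA IH cscalerAr scalerA.
  by rewrite -expiD mulrA rmorphD /= mulrDr mulr1 addrC.
- rewrite -addn1 PoszD opprD upowP // mulrA xsu cscalerAl.
  rewrite -[star u * x * _]mulrA IH cscalerAr scalerA -expiD mulrA.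
  by rewrite rmorphB /= mulrBr mulr1 addrC.
Qed.

Lemma upow_commute_phase t u v m n : unitary u -> unitary v ->
  v * u = expi t *: (u * v) ->
  upow v m * upow u n = expi (t * m%:~R * n%:~R) *: (upow u n * upow v m).
Proof.
move=> uu uv vu; apply: commute_phase_upow => //.
(* It remains to move [upow v m] past [u]. The one-sided lemma moves [u] past powers of [v], so it
   is fed the reversed relation, whose phase is opposite. *)
have uv' : u * v = expi (- t) *: (v * u).
  by rewrite vu scalerA -expiD addNr expi0 scale1r.
rewrite (commute_phase_upow _ uv uv') scalerA -expiD mulNr subrr expi0.
by rewrite scale1r.
Qed.

(* The Weyl operators of a pair: the phase symmetrises [u ^ m * v ^ n]. *)
Definition weyl (theta : R) u v m n : A :=
  expi (pi * theta * m%:~R * n%:~R) *: (upow u m * upow v n).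

Lemma unitary_weyl theta u v m n :
  unitary u -> unitary v -> unitary (weyl theta u v m n).
Proof.
by move=> uu uv; apply/unitaryZ/unitaryM; apply: unitary_upow.
Qed.

(** Moving v^n past u^m' contributes 2nm' (in units of pi theta), while the symmetrising phase of
    the product absorbs mn' + nm'. The antisymmetric difference nm' - mn' is left. *)
Lemma weylM theta u v m n m' n' : unitary u -> unitary v ->
  v * u = expi (2 * pi * theta) *: (u * v) ->
  weyl theta u v m n * weyl theta u v m' n' =
  expi (pi * theta * (n * m' - m * n')%:~R) *:
    weyl theta u v (m + m') (n + n').
Proof.
move=> uu uv vu; rewrite /weyl cscalerMM -expiD.
rewrite mulrA -[_ * upow u m']mulrA (upow_commute_phase _ _ uu uv vu).
rewrite cscalerAr cscalerAl !scalerA -!expiD.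
rewrite !upowD // !mulrA; congr (expi _ *: _).
by rewrite !rmorphB !rmorphM !rmorphD /=; ring.
Qed.

Lemma weyl_commute theta u v u' v' m n m' n' :
  unitary u -> unitary v -> unitary u' -> unitary v' ->
  u' * u = u * u' -> v' * u = u * v' -> u' * v = v * u' -> v' * v = v * v' ->
  weyl theta u' v' m' n' * weyl theta u v m n =
  weyl theta u v m n * weyl theta u' v' m' n'.
Proof.
move=> uu uv uu' uv' c1 c2 c3 c4.
have comm x y k l : unitary x -> unitary y -> y * x = x * y ->
    upow y k * upow x l = upow x l * upow y k.
  move=> ux uy e; rewrite (@upow_commute_phase 0 x y) ?expi0 ?scale1r //.
  by rewrite !mul0r expi0 scale1r.
rewrite /weyl !cscalerMM [expi _ * expi _]mulrC.
congr (_ *: _).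
rewrite !mulrA -[_ * _ * upow u m]mulrA (comm u v') // mulrA (comm u u') //.
rewrite -!mulrA; congr (_ * _).
by rewrite !mulrA -[_ * _ * upow v n]mulrA (comm v v') // mulrA (comm v u').
Qed.

End Unitaries.

(** * The exponent of the cocycle and the group preserving it *)

Section Cocycle.
Variables (R : realType) (d : nat) (Theta : 'M[R]_d).
Implicit Types (x y z : 'cV[int]_d) (M N : 'M[int]_d).

Definition skew_form x y : R :=
  ((Theta *m map_mx intr x)^T *m map_mx intr y) 0 0.

Lemma omegaE x y : omega Theta x y = expi (pi * skew_form x y).
Proof. by []. Qed.

Lemma skew_formC x y : Theta^T = - Theta -> skew_form x y = - skew_form y x.
Proof.
move=> sk; rewrite /skew_form -[LHS]/(_ 0 0) -[in LHS](trmxK (_ *m _)) mxE.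
rewrite !trmx_mul !trmxK sk mulmxA mulmxN mulNmx.
by rewrite [in RHS]mxE opprK.
Qed.

Lemma skew_formxx x : Theta^T = - Theta -> skew_form x x = 0.
Proof.
move=> sk; have /eqP := skew_formC x x sk.
by rewrite -addr_eq0 -mulr2n mulrn_eq0 => /eqP.
Qed.

Lemma skew_formNr x y : skew_form x (- y) = - skew_form x y.
Proof. by rewrite /skew_form map_mxN mulmxN mxE. Qed.

Lemma skew_form0r x : skew_form x 0 = 0.
Proof. by rewrite /skew_form map_mx0 mulmx0 mxE. Qed.

Lemma skew_form_delta j k : skew_form (delta_mx j 0) (delta_mx k 0) = Theta k j.
Proof.
by rewrite /skew_form !map_delta_mx -!colE !mxE.
Qed.

Lemma skew_form_G M x y : G_ Theta M ->
  skew_form (M *m x) (M *m y) = skew_form x y.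
Proof.
move=> [_ MT]; rewrite /skew_form !map_mxM !trmx_mul.
rewrite -[in RHS]MT !trmx_mul trmxK.
by rewrite !mulmxA.
Qed.

Lemma G_1 : G_ Theta 1%:M.
Proof. by split; rewrite ?unitmx1 // map_mx1 trmx1 mulmx1 mul1mx. Qed.

Lemma G_mul M N : G_ Theta M -> G_ Theta N -> G_ Theta (M *m N).
Proof.
move=> [Mu MT] [Nu NT]; split; first by rewrite unitmx_mul Mu.
by rewrite -[RHS]NT -[in RHS]MT map_mxM trmx_mul !mulmxA.
Qed.

Lemma G_inv M : G_ Theta M -> G_ Theta (invmx M).
Proof.
move=> [Mu MT]; split; first by rewrite unitmx_inv.
set N := map_mx intr (invmx M) : 'M[R]_d.
have MN : map_mx intr M *m N = 1%:M by rewrite -map_mxM mulmxV // map_mx1.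
rewrite -[in LHS]MT !mulmxA -trmx_mul MN trmx1 mul1mx -mulmxA MN mulmx1.
by [].
Qed.

End Cocycle.

(** * Cocycle families and endomorphisms permuting them *)

Section CanonicalUnitaries.
Variables (R : realType) (d : nat) (Theta : 'M[R]_d) (A : cstarType R).
Variables (u : 'I_d -> A) (l : 'cV[int]_d -> A).
Hypotheses (sk : Theta^T = - Theta) (lP : canonical_unitaries Theta u l).

Lemma canonical_unitary0 : l 0 = 1.
Proof.
have [lu lm _] := lP; apply: (unitaryI (lu 0)).
by rewrite lm omegaE skew_form0r mulr0 expi0 scale1r addr0 mulr1.
Qed.

(** By skewness <Theta x, x> = 0, so [l x * l (- x)] is [l 0 = 1] without a phase. *)
Lemma canonical_unitaryN x : l (- x) = star (l x).
Proof.
have [lu lm _] := lP; apply: (unitaryI (lu x)); rewrite (proj2 (lu x)) lm.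
by rewrite omegaE skew_formNr skew_formxx // oppr0 mulr0 expi0 scale1r subrr
  canonical_unitary0.
Qed.

(** The two orders of multiplication differ by the phase exp(pi i (Theta_kj - Theta_jk)), which
    skewness turns into exp(2 pi i Theta_kj); [M] leaves these exponents unchanged. *)
Lemma nc_relations_G M : G_ Theta M ->
  nc_relations Theta (fun j => l (M *m delta_mx j 0)).
Proof.
have [lu lm _] := lP; move=> MG; split=> // j k.
rewrite !lm !omegaE !skew_form_G // !skew_form_delta scalerA -expiD.
rewrite [_ *m delta_mx k 0 + _]addrC; congr (expi _ *: _).
have -> : Theta j k = - Theta k j by have /matrixP/(_ k j) := sk; rewrite !mxE.
by ring.
Qed.

End CanonicalUnitaries.

Lemma star_homZ (R : realType) (A : cstarType R) (f : A -> A) a x :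
  star_hom f -> f (a *: x) = a *: f x.
Proof.
move=> [fl _ _]; have f0 : f 0 = 0.
  (* With scalar -1 and zero vectors, linearity reads f 0 = - f 0 + f 0. *)
  by have := fl (-1) 0 0; rewrite !scaleN1r oppr0 addr0 addNr.
by have := fl a x 0; rewrite f0 !addr0.
Qed.

Lemma star_hom_comp (R : realType) (A : cstarType R) (f g : A -> A) :
  star_hom f -> star_hom g -> star_hom (f \o g).
Proof.
move=> [fl [f1 fM] fs] [gl [g1 gM] gs]; split=> /=.
- by move=> a x y /=; rewrite gl fl.
- by split=> [|x y] /=; rewrite ?g1 // gM fM.
- by move=> x /=; rewrite gs fs.
Qed.

Lemma colZ_ind (d : nat) (P : 'cV[int]_d -> Prop) :
  P 0 -> (forall x y, P x -> P y -> P (x + y)) -> (forall x, P x -> P (- x)) ->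
  (forall j, P (delta_mx j 0)) -> forall x, P x.
Proof.
move=> P0 PD PN Pd x; rewrite (matrix_sum_delta x).
apply: (big_ind P) => // i _; rewrite big_ord1.
elim/int_ind: (x i 0) => [|k IH|k IH]; first by rewrite scale0r.
  by rewrite -[k.+1]addn1 PoszD scalerDl scale1r; apply: PD.
rewrite -[k.+1]addn1 PoszD opprD scalerDl scaleN1r; apply: PD => //; exact: PN.
Qed.

(** Induction over the generators of Z^d: [l (x + y)] is a phase times [l x * l y], and [M]
    preserves that phase because it preserves [Theta]. *)
Lemma star_hom_canonical (R : realType) (d : nat) (Theta : 'M[R]_d)
    (A : cstarType R) (u : 'I_d -> A) l (f : A -> A) (M : 'M[int]_d) :
  Theta^T = - Theta -> canonical_unitaries Theta u l -> G_ Theta M ->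
  star_hom f -> (forall j, f (u j) = l (M *m delta_mx j 0)) ->
  forall x, f (l x) = l (M *m x).
Proof.
move=> sk lP MG fh fu; have [_ [f1 fM] fs] := fh; have [lu lm ul] := lP.
apply: colZ_ind => [|x y fx fy|x fx|j].
- by rewrite mulmx0 !(canonical_unitary0 lP).
- have -> : l (x + y) = expi (- (pi * skew_form Theta x y)) *: (l x * l y).
    by rewrite lm omegaE scalerA -expiD addNr expi0 scale1r.
  rewrite star_homZ // fM fx fy lm omegaE skew_form_G // scalerA -expiD addNr.
  by rewrite expi0 scale1r mulmxDr.
- by rewrite mulmxN !(canonical_unitaryN sk lP) fs fx.
- by rewrite -ul fu.
Qed.

(** * From the universal property to the action of a cyclic group *)

Section Action.
Variables (R : realType) (d : nat) (Theta : 'M[R]_d.+1) (A : cstarType R).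
Variables (u : 'I_d.+1 -> A) (l : 'cV[int]_d.+1 -> A).
Hypotheses (sk : Theta^T = - Theta) (torusA : is_nc_torus Theta u)
  (lP : canonical_unitaries Theta u l).

(** The family [g \o u] again satisfies the torus relations, and both [f] and [g] are maps sending
    [u] to it; uniqueness in the universal property identifies them. *)
Lemma star_hom_ext (f g : A -> A) : star_hom f -> star_hom g ->
  (forall x, f (l x) = g (l x)) -> f = g.
Proof.
move=> fh gh fg; have [_ _ ul] := lP.
have gr : nc_relations Theta (g \o u).
  have [[uu ur] _] := torusA; have [_ [g1 gM] gs] := gh.
  split=> [j|j k] /=.
    by have [e1 e2] := uu j; split; rewrite -gs -gM ?e1 ?e2 g1.
  by rewrite -!gM ur star_homZ.
have [_ /(_ _ _ gr) [h [_ hu]]] := torusA.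
rewrite -(hu f) ?(hu g) //; split=> // j /=.
by rewrite ul fg.
Qed.

Lemma canonical_automorphisms : exists beta : 'M[int]_d.+1 -> A -> A,
  forall M, G_ Theta M ->
    star_hom (beta M) /\ forall x, beta M (l x) = l (M *m x).
Proof.
suff /boolp.choice [beta betaP] : forall M, exists f : A -> A, G_ Theta M ->
  star_hom f /\ forall x, f (l x) = l (M *m x) by exists beta.
(* Choice asks for a value at every matrix; off [G_ Theta] the identity serves as a default. *)
move=> M; have [MG|] := pselect (G_ Theta M); last by move=> nMG; exists id.
have [_ /(_ _ _ (nc_relations_G sk lP MG)) [f [[fh fu] _]]] := torusA.
by exists f => _; split=> //; exact: (star_hom_canonical sk lP MG fh fu).
Qed.

Lemma cyclic_group_subgroup (M : 'M[int]_d.+1) :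
  M \in unitmx -> is_subgroup (cyclic_group M).
Proof.
move=> Mu; split.
- by move=> _ [k _ <-]; apply: (unitrXz k Mu).
- by exists 0.
- move=> _ _ [j _ <-] [k _ <-]; exists (j + k) => //.
  by rewrite (exprzDr Mu).
- by move=> _ [k _ <-]; exists (- k) => //; rewrite -invr_expz.
Qed.

Lemma cyclic_group_sub (M : 'M[int]_d.+1) :
  G_ Theta M -> cyclic_group M `<=` G_ Theta.
Proof.
move=> MG _ [k _ <-].
have XG j : G_ Theta (M ^+ j).
  elim: j => [|j IH]; first exact: G_1.
  by rewrite exprS; apply: G_mul.
case: k => j; first exact: XG.
(* [M ^ Negz j] is by definition the inverse of [M ^+ j.+1]. *)
exact/G_inv/XG.
Qed.

Lemma canonical_Zn_action_exists n (M : 'M[int]_d.+1) :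
  (1 < n)%N -> has_order M n -> G_ Theta M ->
  exists2 alpha : 'Z_n -> A -> A, canonical_Zn_action Theta l M alpha &
    exists2 phi : A -> A, induced_by alpha phi &
      forall x, phi (l x) = l (M *m x).
Proof.
move=> n1 Mn MG; have [beta betaP] := canonical_automorphisms.
have b1 : beta 1%:M = id.
  have [bh bl] := betaP _ (G_1 Theta).
  by apply: star_hom_ext => // x; rewrite bl mul1mx.
have bM N N' : G_ Theta N -> G_ Theta N' ->
    beta (N *m N') = beta N \o beta N'.
  move=> NG NG'; have [bh bl] := betaP _ (G_mul NG NG').
  have [bh1 bl1] := betaP _ NG; have [bh2 bl2] := betaP _ NG'.
  apply: star_hom_ext => //; first exact: star_hom_comp.
  by move=> x /=; rewrite bl bl2 bl1 mulmxA.
have baut N : G_ Theta N -> star_automorphism (beta N).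
  move=> NG; split; first by have [] := betaP _ NG.
  (* Bijectivity comes from multiplicativity: the endomorphism of the inverse matrix is a two-sided
     inverse. *)
  have NG' := G_inv NG; have [Nu _] := NG; exists (beta (invmx N)) => a.
    by rewrite -[LHS]/((beta (invmx N) \o beta N) a) -bM // mulVmx // b1.
  by rewrite -[LHS]/((beta N \o beta (invmx N)) a) -bM // mulmxV // b1.
have Ms := cyclic_group_sub MG.
have XG k : G_ Theta (M ^+ k) by apply: Ms; exists k%:Z.
exists (fun k => beta (M ^+ k)).
  split=> //.
    split=> [k| |j k] //; first exact: baut.
    (* Addition in ['Z_n] is modulo n (the modulus is n as 1 < n), which powers of [M] do not see
       since [M ^+ n = 1]. *)
    rewrite -bM //; congr beta; rewrite -[_ *m _]exprD /=.
    by rewrite expr_mod // Zp_cast //; have [] := Mn.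
  exists beta => //; split=> //.
  - by split=> //; apply: cyclic_group_subgroup; have [] := MG.
  - by move=> N /Ms /baut.
  - by move=> N N' /Ms NG /Ms NG'; apply: bM.
  - by move=> N x /Ms /betaP [].
exists (beta M); last by have [] := betaP _ MG.
split; first exact: baut.
move=> k; elim: (nat_of_ord k) => [|j IH]; first exact: b1.
by rewrite exprS bM // IH.
Qed.

End Action.

(** * Computing with integer 4 by 4 matrices *)

Lemma big_ord4 (V : nmodType) (F : 'I_4 -> V) :
  \sum_i F i = F 0 + F 1 + F 2 + F 3.
Proof.
rewrite !big_ord_recr big_ord0 /= add0r.
by do 3 ?[congr (_ + _)]; congr F; apply: val_inj.
Qed.

Section FourByFour.
Implicit Types r s : seq (seq int).

(** Products are taken on lists of rows, so that orders of matrices and invariance of the form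
    become closed computations for [vm_compute]. *)
Definition mulrows r s : seq (seq int) :=
  let e q i j := (nth [::] q i)`_j in
  mkseq (fun i => mkseq (fun j => e r i 0%N * e s 0%N j + e r i 1%N * e s 1%N j
    + e r i 2%N * e s 2%N j + e r i 3%N * e s 3%N j) 4) 4.

Definition trrows r : seq (seq int) :=
  mkseq (fun i => mkseq (fun j => (nth [::] r j)`_i) 4) 4.

Definition onerows : seq (seq int) :=
  mkseq (fun i => mkseq (fun j => (i == j)%:R) 4) 4.

Lemma mul_mx4 r s : mx4 r *m mx4 s = mx4 (mulrows r s).
Proof.
apply/matrixP => i j; rewrite !mxE big_ord4 !mxE /=.
by rewrite nth_mkseq // nth_mkseq.
Qed.

Lemma tr_mx4 r : (mx4 r)^T = mx4 (trrows r).
Proof. by apply/matrixP => i j; rewrite !mxE nth_mkseq // nth_mkseq. Qed.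

Lemma one_mx4 : 1 = mx4 onerows.
Proof. by apply/matrixP => i j; rewrite !mxE nth_mkseq // nth_mkseq. Qed.

Lemma exp_mx4 r k : mx4 r ^+ k = mx4 (iter k (mulrows r) onerows).
Proof.
elim: k => [|k IH]; first by rewrite expr0 one_mx4.
by rewrite exprS IH [LHS]mul_mx4.
Qed.

(** [trrows] tabulates exactly the sixteen entries that [mx4] reads, whatever the shape of the
    lists. *)
Lemma mx4_inj r s : trrows r != trrows s -> mx4 r <> mx4 s.
Proof.
move=> /eqP rs /matrixP e; apply: rs; apply/eq_in_map => i.
rewrite mem_iota /= add0n => i4; apply/eq_in_map => j.
rewrite mem_iota /= add0n => j4.
by have := e (Ordinal j4) (Ordinal i4); rewrite !mxE.
Qed.

Lemma has_order_mx4 r n : (0 < n)%N ->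
  iter n (mulrows r) onerows = onerows ->
  all (fun m => trrows (iter m (mulrows r) onerows) != trrows onerows)
    (iota 1 n.-1) ->
  has_order (mx4 r) n.
Proof.
move=> n0 rn /allP rm; split=> // [|m mn]; first by rewrite exp_mx4 rn one_mx4.
rewrite exp_mx4 one_mx4; apply/mx4_inj/rm.
by rewrite mem_iota add1n prednK.
Qed.

(** [Theta4 theta] is [theta] times this integer matrix J, so invariance reduces to A^t J A = J over
    the integers, for all [theta] at once. *)
Definition symplectic_rows : seq (seq int) :=
  [:: [:: 0; 1; 0; 0]; [:: -1; 0; 0; 0]; [:: 0; 0; 0; 1]; [:: 0; 0; -1; 0]].

Lemma Theta4E (R : realType) (theta : R) :
  Theta4 theta = theta *: map_mx intr (mx4 symplectic_rows).
Proof.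
apply/matrixP => i j; rewrite !mxE.
by case: i => [[|[|[|[|?]]]] ?] //; case: j => [[|[|[|[|?]]]] ?] //=;
  rewrite ?mulr0 ?mulr1 // mulrN1.
Qed.

Lemma G_Theta4 (R : realType) (theta : R) r n : has_order (mx4 r) n ->
  mulrows (mulrows (trrows r) symplectic_rows) r = symplectic_rows ->
  G_ (Theta4 theta) (mx4 r).
Proof.
move=> [n0 rn _] rJ; split.
  (* Finite order already gives invertibility. *)
  have : mx4 r ^+ n \is a GRing.unit by rewrite rn unitr1.
  by rewrite unitrX_pos.
rewrite Theta4E -scalemxAr -scalemxAl map_trmx -!map_mxM tr_mx4 !mul_mx4.
by rewrite rJ.
Qed.

End FourByFour.

(** * The canonical unitaries of the 4-torus *)

Section Torus4.
Variables (R : realType) (theta : R) (A : cstarType R) (u1 u2 u3 u4 : A).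

Definition weyl4 (x : 'cV[int]_4) : A :=
  weyl theta u1 u2 (x 0 0) (x 1 0) * weyl theta u3 u4 (x 2 0) (x 3 0).

Lemma canonical_weyl4 :
  nc_relations (Theta4 theta) (tnth [tuple u1; u2; u3; u4]) ->
  canonical_unitaries (Theta4 theta) (tnth [tuple u1; u2; u3; u4]) weyl4.
Proof.
move=> /nc_relations_Theta4 [[U1 U2 U3 U4] C21 C43 [C31 C41 C32 C42]].
split=> [x|x y|j].
- by apply: unitaryM; apply: unitary_weyl.
(* Exchange the two middle factors, which belong to commuting pairs, and multiply within each pair.
   The exponents add up to theta (x2 y1 - x1 y2 + x4 y3 - x3 y4) = <Theta x, y>. *)
- rewrite /weyl4 mulrA -[_ * _ * weyl _ u1 u2 _ _]mulrA weyl_commute //.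
  rewrite mulrA weylM // -mulrA weylM // cscalerMM -expiD.
  rewrite !mxE omegaE; congr (expi _ *: _).
  rewrite /skew_form !mxE big_ord4 !mxE !big_ord4 !mxE /=.
  by rewrite !rmorphB !rmorphM /=; ring.

- rewrite /weyl4 /weyl !mxE (tnth_nth 0) /=.
  by case: j => [[|[|[|[|?]]]] ?] //=; rewrite ?mulr0 ?mul0r ?expi0 ?scale1r
    ?expr0 ?expr1 ?mulr1 ?mul1r.
Qed.

End Torus4.

Theorem proposition6p4 (R : realType) (theta : R) (A : cstarType R)
    (u1 u2 u3 u4 : A)
    (torusA : is_nc_torus (Theta4 theta) (tnth [tuple u1; u2; u3; u4])) :
  exists2 l : 'cV[int]_4 -> A,
    canonical_unitaries (Theta4 theta) (tnth [tuple u1; u2; u3; u4]) l &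
  [/\ [/\ has_order A5 5, has_order A8 8, has_order A10 10
        & has_order A12 12],
      exists2 alpha5 : 'Z_5 -> A -> A,
        canonical_Zn_action (Theta4 theta) l A5 alpha5 &
        exists2 phi : A -> A, induced_by alpha5 phi &
          [/\ phi u1 = u2 * star u4,
              phi u2 = expi (pi * theta) *: (star u1 * star u2),
              phi u3 = u4
            & phi u4 = expi (pi * theta) *: (star u1 * star u2 * star u3)],
      exists2 alpha8 : 'Z_8 -> A -> A,
        canonical_Zn_action (Theta4 theta) l A8 alpha8 &
        exists2 phi : A -> A, induced_by alpha8 phi &
          [/\ phi u1 = u3, phi u2 = u4, phi u3 = u2 & phi u4 = star u1],
      exists2 alpha10 : 'Z_10 -> A -> A,
        canonical_Zn_action (Theta4 theta) l A10 alpha10 &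
        exists2 phi : A -> A, induced_by alpha10 phi &
          [/\ phi u1 = u2 * star u4,
              phi u2 = expi (- (pi * theta)) *: (star u1 * u2),
              phi u3 = u4
            & phi u4 = expi (- (pi * theta)) *: (star u1 * u2 * star u3)]
    & exists2 alpha12 : 'Z_12 -> A -> A,
        canonical_Zn_action (Theta4 theta) l A12 alpha12 &
        exists2 phi : A -> A, induced_by alpha12 phi &
          [/\ phi u1 = u3, phi u2 = u4, phi u3 = u2
            & phi u4 = expi (- (pi * theta)) *: (star u1 * u2)]].
Proof.
have [rel _] := torusA; have lP := canonical_weyl4 rel.
have sk := Theta4_skew theta.
have o5 : has_order A5 5 by apply: has_order_mx4; vm_compute.
have o8 : has_order A8 8 by apply: has_order_mx4; vm_compute.
have o10 : has_order A10 10 by apply: has_order_mx4; vm_compute.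
have o12 : has_order A12 12 by apply: has_order_mx4; vm_compute.
have [_ _ uE] := lP; set l := weyl4 theta u1 u2 u3 u4 in lP uE *.
(* Since u_j = l(e_j), the image of u_j is [l] at the corresponding column of [M]. *)
have phiE M (phi : A -> A) : (forall x, phi (l x) = l (M *m x)) ->
    [/\ phi u1 = l (col 0 M), phi u2 = l (col 1 M), phi u3 = l (col 2 M)
      & phi u4 = l (col 3 M)].
  have [] := And4 (uE 0) (uE 1) (uE 2) (uE 3).
  rewrite !(tnth_nth 0) /= => e1 e2 e3 e4 pl.
  by split; rewrite colE -pl; congr phi.
pose simp := (mulr0z, mulr1z, mulrN1z, mulr0, mul0r, mulr1, mulrN1, opprK,
  expi0, scale1r, expr0, expr1, mul1r, cscalerAl).
exists l => //; split=> //.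
- have G5 : G_ (Theta4 theta) A5 by apply: (G_Theta4 theta o5); vm_compute.
  have [//|alpha aP [phi ph /phiE phiA]] :=
    canonical_Zn_action_exists sk torusA lP _ o5 G5.
  exists alpha => //; exists phi => //; case: phiA => -> -> -> ->.
  (* A phase appears only where x1 x2 + x3 x4 is nonzero: the images of [u2] and [u4] have x1 = x2 =
     -1, hence exp(pi i theta). *)
  by rewrite /l /weyl4 /weyl !mxE /= !simp.
- have G8 : G_ (Theta4 theta) A8 by apply: (G_Theta4 theta o8); vm_compute.
  have [//|alpha aP [phi ph /phiE phiA]] :=
    canonical_Zn_action_exists sk torusA lP _ o8 G8.
  exists alpha => //; exists phi => //; case: phiA => -> -> -> ->.
  (* All columns are signed basis vectors, so no phase occurs. *)
  by rewrite /l /weyl4 /weyl !mxE /= !simp.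
- have G10 : G_ (Theta4 theta) A10 by apply: (G_Theta4 theta o10); vm_compute.
  have [//|alpha aP [phi ph /phiE phiA]] :=
    canonical_Zn_action_exists sk torusA lP _ o10 G10.
  exists alpha => //; exists phi => //; case: phiA => -> -> -> ->.
  (* Now x1 = -1 and x2 = 1 in the images of [u2] and [u4], so the phase is exp(-pi i theta). *)
  by rewrite /l /weyl4 /weyl !mxE /= !simp.
- have G12 : G_ (Theta4 theta) A12 by apply: (G_Theta4 theta o12); vm_compute.
  have [//|alpha aP [phi ph /phiE phiA]] :=
    canonical_Zn_action_exists sk torusA lP _ o12 G12.
  exists alpha => //; exists phi => //; case: phiA => -> -> -> ->.
  by rewrite /l /weyl4 /weyl !mxE /= !simp.
Qed.
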